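(* Suppose $T^*$ is a minimizer for the problem $$\min_{T\in\mathcal T} L(T)\quad\text{subject to}\quad \sum_{(i,j)\in\mathcal Z}a^l_{ij}t_{ij}=\tilde b^l,\quad l=N_1+1,\dots,N,$$ and that $t^*_{ij}=0$ for some $(i,j)\in\mathcal Z$. Then, for this $(i,j)$, $t_{ij}=0$ for every $T\in\mathcal T$ satisfying $\sum_{(i',j')\in\mathcal Z}a^l_{i'j'}t_{i'j'}=\tilde b^l$ for $l=N_1+1,\dots,N$.
   Context: Let $m,n\ge1$ and $\mathcal Z\subseteq\{1,\dots,m\}\times\{1,\dots,n\}$ be such that every $i$ has at least one $j$ with $(i,j)\in\mathcal Z$ and every $j$ has at least one $i$ with $(i,j)\in\mathcal Z$. The set of allowable plans is $$\mathcal T=\{T=(t_{ij})\in\mathbb R^{m\times n}: t_{ij}\ge0 \text{ if }(i,j)\in\mathcal Z,\ t_{ij}=0\text{ if }(i,j)\notin\mathcal Z\}.$$ For $t\ge0$ and $\tilde t>0$, define $kl(t|\tilde t)=t\log(t/\tilde t)-t+\tilde t$ if $t>0$, and $kl(0|\tilde t)=\tilde t$. Given costs $c_{ij}\in\mathbb R$, a constant $\gamma_0>0$ and reference values $\tilde t_{ij}>0$ for $(i,j)\in\mathcal Z$, put $k_{ij}=\tilde t_{ij}\exp(-c_{ij}/\gamma_0)>0$ for $(i,j)\in\mathcal Z$, $k_{ij}=0$ otherwise, and $K=(k_{ij})$. Let $KL(T|K)=\sum_{(i,j)\in\mathcal Z}kl(t_{ij}|k_{ij})$. Let $N\ge 1$,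 $0\le N_1\le N$, and let $a^l_{ij}\in\mathbb R$ ($(i,j)\in\mathcal Z$) and $\tilde b^l\in\mathbb R$ be given for $l=1,\dots,N$, with $a^l_{ij}\ge0$, $\tilde b^l>0$ and $\gamma_l>0$ for $l=1,\dots,N_1$. The objective is $$L(T)=KL(T|K)+\sum_{l=1}^{N_1}\gamma_l\,kl\Big(\sum_{(i,j)\in\mathcal Z}a^l_{ij}t_{ij}\,\Big|\,\tilde b^l\Big).$$ *)

(* Defs.v *)
From mathcomp Require Import all_boot all_order all_algebra.
From mathcomp Require Import reals sequences exp.

Set Implicit Arguments.
Unset Strict Implicit.
Unset Printing Implicit Defensive.

Import Order.TTheory GRing.Theory Num.Theory.
Local Open Scope ring_scope.

(* Only meaningful for 0 <= t and 0 < s; the [else] branch is the value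
   kl(0|s) = s. *)
Definition kl (R : realType) (t s : R) : R :=
  if 0 < t then t * ln (t / s) - t + s else s.

Definition allowable (R : realType) (m n : nat) (Z : {set 'I_m * 'I_n})
    (T : 'M[R]_(m, n)) : Prop :=
  forall i j, ((i, j) \in Z -> 0 <= T i j) /\ ((i, j) \notin Z -> T i j = 0).

Definition refmx (R : realType) (m n : nat) (Z : {set 'I_m * 'I_n})
    (gamma0 : R) (c tref : 'M[R]_(m, n)) : 'M[R]_(m, n) :=
  \matrix_(i, j) if (i, j) \in Z then tref i j * expR (- c i j / gamma0) else 0.

Definition KL (R : realType) (m n : nat) (Z : {set 'I_m * 'I_n})
    (T K : 'M[R]_(m, n)) : R :=
  \sum_(p in Z) kl (T p.1 p.2) (K p.1 p.2).

Definition lincomb (R : realType) (m n : nat) (Z : {set 'I_m * 'I_n})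
    (A T : 'M[R]_(m, n)) : R :=
  \sum_(p in Z) A p.1 p.2 * T p.1 p.2.

(* Constraint indices run over {0, ..., N-1}: those below N1 are penalized in
   the objective, the others are imposed as equalities.  Entries of c, tref
   and a outside Z, and values of gamma at indices >= N1, are never used. *)
Definition objective (R : realType) (m n : nat) (Z : {set 'I_m * 'I_n})
    (gamma0 : R) (c tref : 'M[R]_(m, n)) (N N1 : nat)
    (a : 'I_N -> 'M[R]_(m, n)) (b gamma : 'I_N -> R) (T : 'M[R]_(m, n)) : R :=
  KL Z T (refmx Z gamma0 c tref)
  + \sum_(l < N | (l < N1)%N) gamma l * kl (lincomb Z (a l) T) (b l).

Definition feasible (R : realType) (m n : nat) (Z : {set 'I_m * 'I_n})
    (N N1 : nat) (a : 'I_N -> 'M[R]_(m, n)) (b : 'I_N -> R)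
    (T : 'M[R]_(m, n)) : Prop :=
  allowable Z T /\ (forall l : 'I_N, (N1 <= l)%N -> lincomb Z (a l) T = b l).

Definition minimizer (R : realType) (X : Type) (D : X -> Prop) (f : X -> R)
    (x : X) : Prop :=
  D x /\ (forall y, D y -> f x <= f y).

(* Main.v *)
Require Import Defs.
From mathcomp Require Import all_boot all_order all_algebra.
From mathcomp Require Import reals sequences exp.
From mathcomp Require Import ring lra.
Import Order.TTheory GRing.Theory Num.Theory.
Local Open Scope ring_scope.

(** The function [t |-> kl t s] is convex and has slope [-oo] at [0], while all
    other terms of the objective are convex and finite on the allowable plans.
    Starting at a plan [S] with a zero entry [p], and moving towards a feasible
    plan [T] whose entry [p] is positive, the gain in that entry therefore beats
    any loss elsewhere, so [S] is no minimizer.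

    No derivative is needed to make this quantitative.  Along the segment from
    [0] to [y] the deviation of [kl] from its chord is explicit
    ([kl_chord_from0]): it is [e * (y * ln e)].  All other terms lie below their
    chords ([kl_convex]).  Hence, with [L] the objective,
      [L ((1 - e) S + e T) <= (1 - e) L S + e L T + e * (T p * ln e)]
    for [0 < e < 1] ([objective_chord]).  If [S] is a minimizer, the left-hand
    side is at least [L S], so that [- (T p * ln e) <= L T - L S] for all such
    [e]; this is absurd since [- ln e] is unbounded. *)

(** * The function [kl] *)

(** At [t = 0] the term [t * ln (t / s)] vanishes whatever [ln 0] is, so the
    formula for positive [t] extends to [0]. *)
Lemma klE {R : realType} (t s : R) :
  0 <= t -> kl t s = t * ln (t / s) - t + s.
Proof.
rewrite /kl le_eqVlt => /orP[/eqP<-|->//].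
by rewrite ltxx !mul0r subr0 add0r.
Qed.

(** The terms in [ln s] cancel; for [x > 0] what remains is [x] times
    [ln (z / x) <= z / x - 1], and for [x = 0] it is [s - z <= s]. *)
Lemma kl_tangent {R : realType} (x z s : R) : 0 <= x -> 0 < z -> 0 < s ->
  kl z s + (x - z) * ln (z / s) <= kl x s.
Proof.
move=> x0 z0 s0; rewrite (klE _ _ (ltW z0)) klE //.
move: x0; rewrite le_eqVlt => /orP[/eqP<-|x0].
  by rewrite mul0r; lra.
rewrite !ln_div ?posrE //.
have h : ln z - ln x <= z / x - 1.
  rewrite -ln_div ?posrE //.
  have zx0 : 0 < z / x by rewrite divr_gt0.
  have := @le_ln1Dx R (z / x - 1).
  by rewrite [1 + _]addrC subrK; apply; lra.
have : x * (ln z - ln x) <= z - x.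
  have -> : z - x = x * (z / x - 1) by field; rewrite gt_eqF.
  by rewrite ler_pM2l.
by lra.
Qed.

Lemma kl_convex {R : realType} (x y s e : R) :
  0 <= x -> 0 <= y -> 0 < s -> 0 < e < 1 ->
  kl ((1 - e) * x + e * y) s <= (1 - e) * kl x s + e * kl y s.
Proof.
move=> x0 y0 s0 /andP[e0 e1]; set z := _ + e * y.
have e0' : 0 < 1 - e by rewrite subr_gt0.
have hx : 0 <= (1 - e) * x by rewrite mulr_ge0 // ltW.
have hy : 0 <= e * y by rewrite mulr_ge0 // ltW.
have : 0 <= z by rewrite addr_ge0.
rewrite le_eqVlt => /orP[z0|z0].
  (* No tangent at [0]; but then both end points are [0]. *)
  move: z0; rewrite eq_sym paddr_eq0 // !mulf_eq0 !(gt_eqF e0) (gt_eqF e0') /=.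
  by rewrite /z => /andP[/eqP-> /eqP->]; rewrite !mulr0 addr0; lra.
have tx : (1 - e) * (kl z s + (x - z) * ln (z / s)) <= (1 - e) * kl x s.
  by rewrite ler_pM2l // kl_tangent.
have ty : e * (kl z s + (y - z) * ln (z / s)) <= e * kl y s.
  by rewrite ler_pM2l // kl_tangent.
apply: le_trans (lerD tx ty); rewrite le_eqVlt; apply/orP; left; apply/eqP.
by rewrite /z; ring.
Qed.

Lemma kl_chord_from0 {R : realType} (y s e : R) :
  0 < y -> 0 < s -> 0 < e ->
  kl (e * y) s = (1 - e) * kl 0 s + e * kl y s + e * (y * ln e).
Proof.
move=> y0 s0 e0; have ey0 : 0 < e * y by rewrite mulr_gt0.
rewrite !(klE _ s) ?(ltW ey0) ?(ltW y0) // mul0r !ln_div ?lnM ?posrE //; ring.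
Qed.

(** * The objective along a segment *)

Definition segment {R : realType} {m n : nat} (S T : 'M[R]_(m, n)) (e : R) :
  'M[R]_(m, n) := (1 - e) *: S + e *: T.

Lemma segmentE {R : realType} {m n : nat} (S T : 'M[R]_(m, n)) (e : R) i j :
  segment S T e i j = (1 - e) * S i j + e * T i j.
Proof. by rewrite !mxE. Qed.

Lemma lincomb_segment {R : realType} {m n : nat} (Z : {set 'I_m * 'I_n})
    (A S T : 'M[R]_(m, n)) (e : R) :
  lincomb Z A (segment S T e) = (1 - e) * lincomb Z A S + e * lincomb Z A T.
Proof.
rewrite /lincomb !mulr_sumr -big_split; apply: eq_bigr => p _ /=.
by rewrite segmentE; ring.
Qed.

Lemma lincomb_ge0 {R : realType} {m n : nat} (Z : {set 'I_m * 'I_n})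
    (A T : 'M[R]_(m, n)) :
  (forall i j, (i, j) \in Z -> 0 <= A i j) -> allowable Z T ->
  0 <= lincomb Z A T.
Proof.
move=> hA hT; apply: sumr_ge0 => -[i j] hij; apply: mulr_ge0; first exact: hA.
exact: (hT i j).1.
Qed.

Lemma feasible_segment {R : realType} {m n N N1 : nat}
    (Z : {set 'I_m * 'I_n}) (a : 'I_N -> 'M[R]_(m, n)) (b : 'I_N -> R)
    (S T : 'M[R]_(m, n)) (e : R) :
  0 <= e <= 1 -> feasible Z N1 a b S -> feasible Z N1 a b T ->
  feasible Z N1 a b (segment S T e).
Proof.
move=> /andP[e0 e1] [hS cS] [hT cT]; split=> [i j|l hl]; last first.
  by rewrite lincomb_segment cS // cT //; ring.
rewrite segmentE; split=> hij; last by rewrite (hS i j).2 // (hT i j).2 //; ring.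
by rewrite addr_ge0 // mulr_ge0 ?subr_ge0 //; [exact: (hS i j).1|exact: (hT i j).1].
Qed.

Lemma KL_chord {R : realType} {m n : nat} (Z : {set 'I_m * 'I_n})
    (K S T : 'M[R]_(m, n)) (e : R) (i : 'I_m) (j : 'I_n) :
  (forall i j, (i, j) \in Z -> 0 < K i j) ->
  allowable Z S -> allowable Z T -> 0 < e < 1 ->
  (i, j) \in Z -> S i j = 0 -> 0 < T i j ->
  KL Z (segment S T e) K
  <= (1 - e) * KL Z S K + e * KL Z T K + e * (T i j * ln e).
Proof.
move=> hK hS hT e01 hij S0 T0; have /andP[e0 _] := e01.
rewrite /KL !(bigD1 (i, j) hij) /=.
rewrite segmentE S0 mulr0 add0r kl_chord_from0 //; last exact: hK.
set rest := (X in _ + X <= _); set restS := (X in (1 - e) * (_ + X)).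
set restT := (X in e * (_ + X)).
suff : rest <= (1 - e) * restS + e * restT by lra.
rewrite /rest /restS /restT !mulr_sumr -big_split; apply: ler_sum.
move=> [i' j'] /andP[h _] /=; rewrite segmentE.
by apply: kl_convex => //; [exact: (hS _ _).1|exact: (hT _ _).1|exact: hK].
Qed.

Lemma refmx_gt0 {R : realType} {m n : nat} (Z : {set 'I_m * 'I_n})
    (gamma0 : R) (c tref : 'M[R]_(m, n)) :
  (forall i j, (i, j) \in Z -> 0 < tref i j) ->
  forall i j, (i, j) \in Z -> 0 < refmx Z gamma0 c tref i j.
Proof. by move=> h i j hij; rewrite mxE hij mulr_gt0 ?h ?expR_gt0. Qed.

(** The penalties are convex in the plan, being nonnegative multiples of [kl]
    composed with linear forms that are nonnegative on allowable plans; so the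
    gain [e * (T i j * ln e)] of [KL_chord] is preserved. *)
Lemma objective_chord {R : realType} {m n N N1 : nat}
    (Z : {set 'I_m * 'I_n}) (gamma0 : R) (c tref : 'M[R]_(m, n))
    (a : 'I_N -> 'M[R]_(m, n)) (b gamma : 'I_N -> R)
    (S T : 'M[R]_(m, n)) (e : R) (i : 'I_m) (j : 'I_n) :
  (forall i j, (i, j) \in Z -> 0 < tref i j) ->
  (forall l : 'I_N, (l < N1)%N -> forall i j, (i, j) \in Z -> 0 <= a l i j) ->
  (forall l : 'I_N, (l < N1)%N -> 0 < b l) ->
  (forall l : 'I_N, (l < N1)%N -> 0 <= gamma l) ->
  allowable Z S -> allowable Z T -> 0 < e < 1 ->
  (i, j) \in Z -> S i j = 0 -> 0 < T i j ->
  let L := objective Z gamma0 c tref N1 a b gamma in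
  L (segment S T e) <= (1 - e) * L S + e * L T + e * (T i j * ln e).
Proof.
move=> htref ha hb hgamma hS hT e01 hij S0 T0 /=; rewrite /objective.
have := KL_chord Z _ S T e i j (refmx_gt0 Z gamma0 c tref htref) hS hT e01 hij S0 T0.
set pen := (X in _ -> _ + X <= _); set penS := (X in (1 - e) * (_ + X)).
set penT := (X in e * (_ + X)).
suff : pen <= (1 - e) * penS + e * penT by lra.
rewrite /pen /penS /penT !mulr_sumr -big_split; apply: ler_sum => l hl /=.
have -> : forall x y : R, (1 - e) * (gamma l * x) + e * (gamma l * y)
    = gamma l * ((1 - e) * x + e * y) by move=> x y; ring.
rewrite ler_wpM2l ?hgamma // lincomb_segment kl_convex ?hb //.
  by apply: lincomb_ge0 => //; exact: ha.
by apply: lincomb_ge0 => //; exact: ha.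
Qed.

(** * Zero entries of a minimizer *)

Theorem corollary1 (R : realType) (m n : nat) (hm : (1 <= m)%N) (hn : (1 <= n)%N)
  (Z : {set 'I_m * 'I_n})
  (hZrow : forall i, exists j, (i, j) \in Z)
  (hZcol : forall j, exists i, (i, j) \in Z)
  (c tref : 'M[R]_(m, n)) (gamma0 : R) (hgamma0 : 0 < gamma0)
  (htref : forall i j, (i, j) \in Z -> 0 < tref i j)
  (N N1 : nat) (hN : (1 <= N)%N) (hN1 : (N1 <= N)%N)
  (a : 'I_N -> 'M[R]_(m, n)) (b gamma : 'I_N -> R)
  (ha : forall l : 'I_N, (l < N1)%N ->
          forall i j, (i, j) \in Z -> 0 <= a l i j)
  (hb : forall l : 'I_N, (l < N1)%N -> 0 < b l)
  (hgamma : forall l : 'I_N, (l < N1)%N -> 0 < gamma l)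
  (Tstar : 'M[R]_(m, n))
  (hTstar : minimizer (feasible Z N1 a b)
              (objective Z gamma0 c tref N1 a b gamma) Tstar)
  (i : 'I_m) (j : 'I_n) (hij : (i, j) \in Z) (hzero : Tstar i j = 0) :
  forall T : 'M[R]_(m, n), feasible Z N1 a b T -> T i j = 0.
Proof.
move=> T hT; have [optS minS] := hTstar.
have : 0 <= T i j by exact: (hT.1 i j).1.
rewrite le_eqVlt => /orP[/eqP<-//|T0]; exfalso.
set L := objective _ _ _ _ _ _ _ _ in minS.
have LST : 0 <= L T - L Tstar by rewrite subr_ge0 minS.
(* This [e] solves [T i j * ln e = - (L T - L Tstar + 1)], so that the chord
   bound falls short of [L Tstar] by exactly [e]. *)
pose e := expR (- ((L T - L Tstar + 1) / T i j)).
have e01 : 0 < e < 1.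
  by rewrite expR_gt0 expR_lt1 oppr_lt0 divr_gt0 // ltr_wpDl.
have /andP[e0 /ltW e1] := e01.
have lne : T i j * ln e = - (L T - L Tstar + 1).
  by rewrite expRK mulrN mulrC divfK ?gt_eqF.
have hseg : feasible Z N1 a b (segment Tstar T e).
  by apply: feasible_segment => //; rewrite ltW.
have := le_trans (minS _ hseg) (objective_chord Z gamma0 c tref a b gamma
  Tstar T e i j htref ha hb (fun l hl => ltW (hgamma l hl))
  optS.1 hT.1 e01 hij hzero T0).
rewrite -/L lne.
have -> : (1 - e) * L Tstar + e * L T + e * - (L T - L Tstar + 1)
  = L Tstar - e by ring.
by lra.
Qed.
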